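(* Let $p$ be a prime and let $G$ be a finite $p$-group that is neither cyclic nor a generalized quaternion group. Then $G$ has a decreasing sequence of normal subgroups $$G\supseteq \Phi(G)=N_0\supseteq N_1\supseteq\cdots\supseteq N_m=\{e\}$$ such that for every $0\le i<m$: (1) $[N_i:N_{i+1}]=p$; and (2) the extension $0\to N_i/N_{i+1}\to G/N_{i+1}\xrightarrow{\pi}G/N_i\to 0$, with $\pi$ the natural projection, is a forcing extension.
   Context: $\Phi(G)$ is the Frattini subgroup of $G$ (the intersection of all maximal subgroups). A group extension $0\to H\to\tilde G\xrightarrow{\pi}G\to 0$ is forcing if there exists a conjugacy class $\mathcal{C}\subset G$ such that for every $c\in\mathcal{C}$, every element of $\pi^{-1}(c)$ has the same order as $c$. The generalized quaternion group is $Q(n)=\langle x,y\mid x^{2^{n+1}}=y^4=1,\ x^{2^n}=y^2,\ y^{-1}xy=x^{-1}\rangle$ for $n\ge1$. *)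

(* Defs.v *)
From HB Require Import structures.
From mathcomp Require Import all_boot all_fingroup all_solvable.

Set Implicit Arguments.
Unset Strict Implicit.
Unset Printing Implicit Defensive.

Local Open Scope group_scope.

(* This is 'Q_(2 ^ n.+2) (see [gen_quaternionE]).  In MathComp, [x ^ y] on   *)
(* group elements is y^-1 * x * y.                                           *)
Definition gen_quaternion (gT : finGroupType) (G : {set gT}) (n : nat) : Prop :=
  G \isog Grp (x : y : x ^+ (2 ^ n.+1)%N, y ^+ 4, x ^+ (2 ^ n)%N = y ^+ 2,
                       x ^ y = x^-1).

Lemma gen_quaternionE (gT : finGroupType) (G : {group gT}) (n : nat) :
  0 < n -> gen_quaternion G n <-> G \isog 'Q_(2 ^ n.+2).
Proof.
move=> n_gt0; have isoQ := @Grp_quaternion n.+2 n_gt0.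
have eqP rT (H : {group rT}) :
  (H \homg Grp (x : y : x ^+ (2 ^ n.+1)%N, y ^+ 4, x ^+ (2 ^ n)%N = y ^+ 2,
                        x ^ y = x^-1)) = (H \homg 'Q_(2 ^ n.+2)).
  rewrite isoQ; apply: eq_existsb => -[x y] /=; rewrite !xpair_eqE.
  congr (_ && _); rewrite [y ^+ 2 == _]eq_sym; apply: andb_id2l => /eqP xq1.
  rewrite andbA; congr (_ && _); apply: andb_idl => /eqP xr.
  by rewrite (expgM y 2 2) -xr -expgM -expnSr xq1.
split=> [isoG | isoG rT H]; last by rewrite eqP; apply: eq_homgr.
rewrite isogEhom; apply/andP; split.
  by rewrite -eqP; apply: isoGrp_hom.
by rewrite isoG eqP homg_refl.
Qed.

Definition is_gen_quaternion (gT : finGroupType) (G : {set gT}) : Prop :=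
  exists2 n : nat, 0 < n & gen_quaternion G n.

Definition group_extension (aT gT rT : finGroupType)
    (H : {group aT}) (Gt : {group gT}) (G : {group rT})
    (iota : {morphism H >-> gT}) (pi : {morphism Gt >-> rT}) : Prop :=
  [/\ 'injm iota, iota @* H = 'ker pi & pi @* Gt = G].

Definition forcing_extension (aT gT rT : finGroupType)
    (H : {group aT}) (Gt : {group gT}) (G : {group rT})
    (iota : {morphism H >-> gT}) (pi : {morphism Gt >-> rT}) : Prop :=
  group_extension G iota pi /\
  exists2 C : {set rT}, C \in classes G &
    forall c, c \in C -> forall x, x \in Gt -> pi x = c -> #[x] = #[c].

(* For M \subset N both normal in G, this determines pi on its domain.       *)
Definition natural_projection (gT : finGroupType) (G M N : {group gT})
    (pi : {morphism G / M >-> coset_of N}) : Prop :=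
  forall x, x \in G -> pi (coset M x) = coset N x.

(* Main.v *)
Require Import Defs.
From mathcomp Require Import all_boot all_fingroup all_solvable.

Local Open Scope group_scope.

(* For a central subgroup Z of order p, the extension Z -> H -> H/Z of a      *)
(* p-group is forcing as soon as H has a subgroup of order p other than Z,    *)
(* and this fails only if H is cyclic or generalized quaternion.  Quotients   *)
(* of G by subgroups of Phi(G) are not cyclic, so only quaternion quotients   *)
(* must be avoided.  Any chief series of G below Phi(G) passing through G'    *)
(* does this: quotients by N containing G' are abelian, and if G/N were       *)
(* quaternion with 1 < N <= G', then replacing G by G/M with M of index 2     *)
(* in N would make the quaternion group a central quotient of a group by a    *)
(* subgroup of order 2 of its derived group, which is impossible.             *)

(** The invariant carried down the series by [normal_chain_der1] is that each term is comparable
    with [G^](1)[;]'Phi(G)[qualifies because it contains]G^[(1)]. By [prime_Ohm1P], a nontrivial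
    p-group whose ['Ohm_1] has order p is cyclic or quaternion. [forcing_extension_Ohm1] turns the
    failure of this condition into forcing, and [quotient_der1_not_quaternion] excludes the hard
    quaternion case. *)

Lemma pgroup_normal_prime_central (p : nat) (gT : finGroupType)
    (G Z : {group gT}) :
  prime p -> p.-group G -> Z <| G -> #|Z| = p -> Z \subset 'Z(G).
Proof.
move=> p_pr pG nsZG oZ; apply: prime_meetG; first by rewrite oZ.
apply: (meet_center_nil (pgroup_nil pG) nsZG).
by rewrite -cardG_gt1 oZ prime_gt1.
Qed.

Lemma central_quotient_quaternion_der1 (gT : finGroupType)
    (G W : {group gT}) (n : nat) :
  W \subset 'Z(G) -> #|W| = 2 -> n > 2 -> G / W \isog 'Q_(2 ^ n) ->
  ~~ (W \subset G^`(1)).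
Proof.
move=> sWZ oW n_gt2 isoQ; apply/negP => sWG'.
have [sWG cWG] := subsetIP sWZ.
have nsWG : W <| G by apply: sub_center_normal.
have nWG := normal_norm nsWG.
have [[X Y] genQ [_ Y2 XY]] := generators_quaternion n_gt2 isoQ.
have [_ _ _ defQ _] := extremal_generators_facts (isT : prime 2) genQ.
have [_ GX oX /setDP[GY _]] := genQ.
case/morphimP: GX => x nWx Gx defX; case/morphimP: GY => y nWy Gy defY.
rewrite {}defX {}defY /= in Y2 XY oX defQ *.
have def_n : n = n.-2.+2 by case: n n_gt2 {genQ oX Y2 isoQ} => [|[|[]]].
set r := (2 ^ n.-2)%N in Y2; have r2 : 2 %| r.
  rewrite /r; case: n n_gt2 {genQ oX Y2 isoQ r def_n} => [|[|[]]] // n _.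
  by rewrite expnS dvdn_mulr.
have{} oX : #[coset W x] = (2 * r)%N by rewrite oX {1}def_n expnS.
have cWx u : u \in W -> commute u x by move/(subsetP cWG)/centP; apply.
have cWy u : u \in W -> commute u y by move/(subsetP cWG)/centP; apply.
have [w Ww xy] : exists2 w, w \in W & x ^ y = w * x^-1.
  apply/rcosetP/rcoset_kercosetP; rewrite ?groupV ?groupJ //.
  by rewrite morphJ // morphV.
have xX i : (x ^+ i \in W) = (2 * r %| i).
  rewrite -oX order_dvdn -morphX //; apply/idP/eqP; first exact: coset_id.
  by apply: coset_idr; rewrite groupX.
have even_W u i : u \in W -> 2 %| i -> u ^+ i = 1.
  move=> Wu /dvdnP[j ->]; rewrite mulnC expgM.
  by rewrite -{1}oW expg_cardG // expg1n.
(* y centralises y^2, which is x^r up to a central factor, but it also inverts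
   x^r, because r is even and it inverts x up to a factor of order 2. *)
have x2r : x ^+ (2 * r) = 1.
  have [u Wu yr] : exists2 u, u \in W & y ^+ 2 = u * x ^+ r.
    apply/rcosetP/rcoset_kercosetP; rewrite ?groupX //.
    by rewrite !morphX.
  have xry : (x ^+ r) ^ y = x ^+ r.
    have -> : x ^+ r = u^-1 * y ^+ 2 by rewrite yr mulKg.
    rewrite conjMg conjVg conjXg (conjgE y) mulKg.
    by rewrite conjgE cWy // mulKg.
  have : (x ^+ r) ^ y = x ^- r.
    rewrite conjXg xy expgMn; last by apply/commuteV/cWx.
    by rewrite even_W // mul1g expgVn.
  rewrite xry mul2n -addnn expgD => {1}->.
  by rewrite mulVg.
pose c := w * x ^- 2.
have defc : [~ x, y] = c.
  by rewrite commgEl xy /c expgS expg1 invMg !mulgA (commuteV (cWx w Ww)).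
have cx : c ^ x = c.
  apply/conjg_fixP/commgP/commute_sym/commuteM.
    exact/commute_sym/cWx.
  exact/commuteV/commuteX.
have cy : c ^ y = c^-1.
  rewrite /c conjMg conjVg conjXg xy expgMn; last by apply/commuteV/cWx.
  rewrite (even_W w 2) // mul1g expgVn !invgK invMg invgK.
  have -> : w ^ y = w by rewrite conjgE cWy // mulKg.
  have -> : w^-1 = w by apply/eqP; rewrite eq_invg_mul; apply/eqP/(even_W w 2).
  exact: commuteX (cWx w Ww).
have defG : G :=: <<[set x; y] :|: W>>.
  apply/eqP; rewrite eqEsubset gen_subG !subUset !sub1set Gx Gy sWG !andbT.
  apply/subsetP => g Gg.
  have /= := mem_quotient W Gg; rewrite -defQ.
  case/mulsgP => _ _ /cycleP[i ->] /cycleP[j ->] defg.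
  have /rcosetP[u Wu ->] : g \in W :* (x ^+ i * y ^+ j).
    apply/rcoset_kercosetP; rewrite ?groupM ?groupX ?(subsetP nWG) //.
    by rewrite defg morphM ?groupX // !morphX.
  by rewrite !groupM ?groupX // mem_gen // !inE ?eqxx ?Wu ?orbT.
have nCG : G \subset 'N(<[c]>).
  rewrite defG gen_subG !subUset !sub1set; apply/andP; split.
    apply/andP; split; apply/normP; rewrite -cycleJ ?cx // cy.
    exact: cycleV.
  apply: subset_trans (cent_sub _); rewrite (subset_trans cWG) // centS //.
  by rewrite cycle_subG /c groupM ?groupV ?groupX // (subsetP sWG).
(* Among the generators, the only commutators that can be nontrivial are [c] and its inverse, so the
   generators commute modulo [<[c]>]. *)
have sG'C : G^`(1) \subset <[c]>.
  have nCS : [set x; y] :|: W \subset 'N(<[c]>) by rewrite -gen_subG -defG.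
  apply: der1_min => //; rewrite defG quotient_gen // abelian_gen; apply: quotient_cents2r; rewrite gen_subG.
  apply/subsetP => _ /imset2P[a b Sa Sb ->].
  have Sin z : z \in [set x; y] :|: W -> z \in G by rewrite defG => /mem_gen.
  have cW1 u v : u \in W -> v \in [set x; y] :|: W -> [~ u, v] = 1.
    by move=> Wu /Sin Gv; apply/eqP/commgP; have/centP := subsetP cWG u Wu; apply.
  case/setUP: (Sa) => [Da|/cW1->//].
  case/setUP: (Sb) => [Db|/cW1 ab1]; last by rewrite -invg_comm ab1 ?invg1.
  case/set2P: Da => ->; case/set2P: Db => ->; rewrite ?commgg //.
    by rewrite defc cycle_id.
  by rewrite -invg_comm defc groupV cycle_id.
have trivW : W \subset [1].
  apply/subsetP => u Wu.
  have /cycleP[k defu] := subsetP (subset_trans sWG' sG'C) u Wu.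
  have defck : c ^+ k = w ^+ k * x ^- (2 * k).
    by rewrite expgMn ?expgVn ?expgM //; apply/commuteV/commuteX/cWx.
  (* This forces [2 * r] to divide [2 * k]. Then [k] is a multiple of the even number [r], so
     [w ^+ k] vanishes, and [x ^+ (2 * k)] is a power of [x ^+ (2 * r) = 1]. *)
  have : x ^+ (2 * k) \in W.
    by rewrite -groupV -(groupMl _ (groupX k Ww)) -defck -defu.
  rewrite xX => dv_k; rewrite inE defu defck; move: (dv_k).
  rewrite dvdn_pmul2l // => /(dvdn_trans r2)/(even_W w k Ww)->.
  by case/dvdnP: dv_k => j ->; rewrite mulnC expgM x2r expg1n invg1 mulg1.
by have := subset_leq_card trivW; rewrite cards1 oW.
Qed.

Lemma quotient_der1_not_quaternion (gT : finGroupType) (G N : {group gT}) :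
  2.-group G -> N <| G -> N \subset G^`(1) -> N :!=: 1 ->
  extremal_class (G / N) <> Quaternion.
Proof.
move=> pG nsNG sNG' ntN /quaternion_classP[n n_gt2 isoQ].
have pN := pgroupS (normal_sub nsNG) pG.
have [_ _ [k oN]] := pgroup_pdiv pN ntN.
have [|M [sMN nsMG oM]] := normal_pgroup (r := k) pG nsNG.
  by rewrite oN pfactorK.
have oNM : #|N / M| = 2.
  rewrite card_quotient ?(subset_trans (normal_sub nsNG)) ?normal_norm //.
  by rewrite -divgS // oN oM expnS mulnK ?expn_gt0.
have sZ : N / M \subset 'Z(G / M).
  apply: (@pgroup_normal_prime_central 2 _ (G / M) (N / M)) => //.
    exact: quotient_pgroup.
  exact: quotient_normal.
have /negP[] := @central_quotient_quaternion_der1 _ (G / M)%G (N / M)%G n sZ oNM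
  n_gt2 (isog_trans (third_isog sMN nsMG nsNG) isoQ).
by rewrite /= -quotient_der ?normal_norm // quotientS.
Qed.

Lemma quaternion_not_abelian (gT : finGroupType) (G : {group gT}) :
  extremal_class G = Quaternion -> ~~ abelian G.
Proof.
case/quaternion_classP=> n n_gt2 isoQ.
have [[x y] genG _] := generators_quaternion n_gt2 isoQ.
have [_ [_ _ oG' _] _ _ _] := quaternion_structure n_gt2 genG isoQ.
apply/negP => /derG1P G'1; move: oG'; rewrite G'1 cards1 => /eqP.
by rewrite eq_sym -(expn0 2) eqn_exp2l // -subn2 subn_eq0 leqNgt n_gt2.
Qed.

Lemma extremal_class_gen_quaternion (gT : finGroupType) (G : {group gT}) :
  extremal_class G = Quaternion -> is_gen_quaternion G.
Proof.
case/quaternion_classP=> n n_gt2 isoQ; exists n.-2.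
  by case: n n_gt2 {isoQ} => [|[|[]]].
by case: n n_gt2 isoQ => [|[|[|n]]] // _ isoQ; apply/gen_quaternionE.
Qed.

Lemma exists_natural_projection (gT : finGroupType) (G M N : {group gT}) :
  M <| G -> N <| G -> M \subset N ->
  exists pi : {morphism G / M >-> coset_of N}, natural_projection pi.
Proof.
move=> /andP[_ nMG] /andP[_ nNG] sMN.
(* The choice of representative is harmless: two of them differ by an element of [M], which
   [coset N] kills since [M] lies in [N]. *)
pose f (u : coset_of M) := coset N (repr u).
have fE x : x \in G -> f (coset M x) = coset N x.
  move=> Gx; have nMx := subsetP nMG x Gx; have nNx := subsetP nNG x Gx.
  have := mem_repr_coset (coset M x); rewrite val_coset // => /rcosetP[m Mm Em].
  rewrite /f /= val_coset // Em; have Nm := subsetP sMN m Mm.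
  by rewrite morphM ?(subsetP (normG N) m) //= coset_id // mul1g.
have fM : {in G / M &, {morph f : u v / u * v}}.
  move=> _ _ /morphimP[x nMx Gx ->] /morphimP[y nMy Gy ->].
  by rewrite -morphM //= !fE ?groupM // morphM //= (subsetP nNG).
by exists (Morphism fM).
Qed.

(* Any subgroup of order p other than N / M has a generator whose image also
   has order p, and since N / M is central all lifts of it have order p. *)
Lemma forcing_extension_Ohm1 (p : nat) (gT : finGroupType)
    (G M N : {group gT}) (pi : {morphism G / M >-> coset_of N}) :
  prime p -> p.-group G -> M <| G -> N <| G -> M \subset N ->
  #|N : M| = p -> #|'Ohm_1(G / M)| <> p -> natural_projection pi ->
  forcing_extension (G / N)%G (idm_morphism (N / M)%G) pi.
Proof.
move=> p_pr pG nsMG nsNG sMN iNM oOhm piE.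
have [sNG nNG] := andP nsNG; have [_ nMG] := andP nsMG.
have oZ : #|N / M| = p by rewrite card_quotient ?(subset_trans sNG).
have pGM : p.-group (G / M) by apply: quotient_pgroup.
have sNMGM : N / M \subset G / M by apply: quotientS.
have sZ : N / M \subset 'Z(G / M).
  apply: (@pgroup_normal_prime_central p _ (G / M) (N / M)) => //.
  exact: quotient_normal.
have kerpi : 'ker pi = N / M.
  apply/setP=> u; apply/idP/idP => [/morphpreP[] | ].
    case/morphimP=> x nMx Gx -> /set1P; rewrite piE // => /coset_idr Nx.
    by rewrite mem_quotient // Nx // (subsetP nNG).
  case/morphimP=> x nMx Nx ->; have Gx := subsetP sNG x Nx.
  by apply/kerP; rewrite ?mem_quotient // piE // coset_id.
have impi : pi @* (G / M) = G / N.
  apply/setP=> v; apply/idP/idP => [/morphimP[_ _ /morphimP[x _ Gx ->] ->] | ].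
    by rewrite piE // mem_quotient.
  case/morphimP=> x nNx Gx ->; rewrite /= -(piE x Gx).
  by rewrite mem_morphim ?mem_quotient.
split; first by split=> //; [apply: injm_idm | rewrite /= morphim_idm].
have [u Gu /andP[up Zu]] :
  exists2 u, u \in G / M & (u ^+ p == 1) && (u \notin N / M).
  apply/exists_inP; apply: contra_notT oOhm => /exists_inPn allZ.
  suff -> : 'Ohm_1(G / M) = N / M by [].
  (* If all solutions of [u ^+ p = 1] lay in [N / M], they would generate exactly that group, of
     order p. *)
  apply/eqP; rewrite eqEsubset (OhmE 1 pGM) gen_subG expn1; apply/andP; split.
    apply/subsetP=> u /setIP[Gu]; rewrite inE => up.
    by have := allZ u Gu; rewrite up negbK.
  apply/subsetP=> u Zu; rewrite mem_gen // !inE (subsetP sNMGM) //=.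
  by rewrite -oZ expg_cardG.
exists (pi u ^: (G / N)); first by rewrite mem_classes // -impi mem_morphim.
have opi g : g \in G / N -> #[pi u ^ g] = p.
  move=> Gg; rewrite orderJ; apply: nt_prime_order => //.
    by rewrite -morphX // (eqP up) morph1.
  by apply: contra Zu => /eqP pi1; rewrite -kerpi; apply/kerP.
move=> _ /imsetP[g Gg ->] v Gv piv; rewrite opi //.
move: Gg piv; rewrite -{1}impi => /morphimP[h _ Gh ->]; rewrite -morphJ // => piv.
(* Any lift is [z * u ^ h] with [z] central of order dividing p, so its p-th power is trivial; it is
   not 1 because [pi u] is not. *)
have /rcosetP[z] : v \in 'ker pi :* (u ^ h).
  by apply/rcoset_kerP; rewrite ?groupJ.
rewrite kerpi => Zz defv; apply: nt_prime_order => //; last first.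
  apply: contra Zu => /eqP v1; rewrite -kerpi; apply/kerP => //.
  move/eqP: piv; rewrite v1 morph1 eq_sym morphJ //.
  by rewrite -{1}(conj1g (pi h)) (inj_eq (conjg_inj _)) => /eqP.
rewrite defv expgMn.
  by rewrite -{1}oZ expg_cardG // mul1g -conjXg (eqP up) conj1g.
by have /centerP[_] := subsetP sZ z Zz; apply; rewrite groupJ.
Qed.

Lemma normal_step_der1 (p : nat) (gT : finGroupType) (G N : {group gT}) :
  prime p -> p.-group G -> N <| G -> N :!=: 1 ->
  (N \subset G^`(1)) || (G^`(1) \subset N) ->
  exists M : {group gT}, [/\ M <| G, M \subset N, #|N : M| = p &
    (M \subset G^`(1)) || (G^`(1) \subset M)].
Proof.
move=> p_pr pG nsNG ntN; have pN := pgroupS (normal_sub nsNG) pG.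
have [sNG' | nsNG'] /= := boolP (N \subset G^`(1)).
  have [_ _ [k oN]] := pgroup_pdiv pN ntN.
  have [|M [sMN nsMG oM]] := normal_pgroup (r := k) pG nsNG.
    by rewrite oN pfactorK.
  move=> _; exists M; rewrite (subset_trans sMN sNG'); split=> //.
  by rewrite -divgS // oN oM expnS mulnK // expn_gt0 prime_gt0.
move=> sG'N; have [eqG'N | [M maxM sG'M]] := maximal_exists sG'N.
  by rewrite -eqG'N subxx in nsNG'.
have sMN := maxgroupp maxM; exists M; rewrite sG'M orbT; split=> //.
- apply: sub_der1_normal => //.
  by rewrite (subset_trans (proper_sub sMN)) ?normal_sub.
- exact: proper_sub.
exact: p_maximal_index maxM.
Qed.

Lemma normal_chain_der1 (p : nat) (gT : finGroupType) (G N : {group gT}) :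
  prime p -> p.-group G -> N <| G ->
  (N \subset G^`(1)) || (G^`(1) \subset N) ->
  exists (m : nat) (L : nat -> {group gT}),
    [/\ L 0 = N, L m :=: 1, forall i, i <= m -> L i <| G,
        forall i, i <= m -> (L i \subset G^`(1)) || (G^`(1) \subset L i) &
        forall i, i < m -> L i.+1 \subset L i /\ #|L i : L i.+1| = p].
Proof.
move=> p_pr pG; have [k] := ubnP #|N|; elim: k => // k IHk in N *.
move=> leNk nsNG cmpN; have [N1 | ntN] := eqVneq N 1%G.
  by exists 0, (fun=> N); split=> //; rewrite N1.
have [//|M [nsMG sMN iNM cmpM]] := normal_step_der1 _ _ _ N p_pr pG nsNG _ cmpN.
have [||//|m [L [L0 Lm nL cmpL stepL]]] := IHk M.
- rewrite -ltnS (leq_trans _ leNk) // ltnS proper_card // properE sMN /=.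
  by rewrite -indexg_eq1 iNM neq_ltn prime_gt1 ?orbT.
- by [].
exists m.+1, (fun i => if i is j.+1 then L j else N); split=> // -[|i] //.
- exact: nL.
- exact: cmpL.
- by rewrite L0.
exact: stepL.
Qed.

Theorem theorem4p1 (p : nat) (gT : finGroupType) (G : {group gT}) :
  prime p -> p.-group G -> ~~ cyclic G -> ~ is_gen_quaternion G ->
  exists (m : nat) (N : nat -> {group gT}),
    [/\ N 0 :=: 'Phi(G),
        N m :=: 1,
        forall i, i <= m -> N i <| G,
        forall i, i < m -> N i.+1 \subset N i &
        forall i, i < m ->
          #|N i : N i.+1| = p /\
          exists pi : {morphism G / N i.+1 >-> coset_of (N i)},
            natural_projection pi /\
            forcing_extension (G / N i)%G
              (idm_morphism (N i / N i.+1)%G) pi].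
Proof.
move=> p_pr pG ncycG nQG.
have cmpPhi : ('Phi(G) \subset G^`(1)) || (G^`(1) \subset 'Phi(G)).
  by rewrite (Phi_joing pG) joing_subl orbT.
have [m [N [N0 Nm nN cmpN stepN]]] :=
  normal_chain_der1 p gT G 'Phi(G)%G p_pr pG (Phi_normal G) cmpPhi.
exists m, N; split=> //; first by rewrite N0.
  by move=> i /stepN[].
move=> i lt_i_m; have [sNS iN] := stepN i lt_i_m; split=> //.
have nsN := nN i (ltnW lt_i_m); have nsNS := nN i.+1 lt_i_m.
have [pi piE] := exists_natural_projection gT G _ _ nsNS nsN sNS.
exists pi; split=> //; apply: (forcing_extension_Ohm1 p) => //.
have sNPhi j : j <= m -> N j \subset 'Phi(G).
  elim: j => [_ | j IHj lt_j_m]; first by rewrite N0.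
  by apply: subset_trans (IHj (ltnW lt_j_m)); case: (stepN j lt_j_m).
(* [G / 'Phi(G)] is a quotient of this group, and if it is cyclic then so is [G]. *)
have ncyc : ~~ cyclic (G / N i.+1).
  apply: contra ncycG => cycN; apply: Phi_quotient_cyclic.
  have sSPhi := sNPhi _ lt_i_m.
  rewrite -(isog_cyclic (third_isog sSPhi nsNS (Phi_normal G))).
  exact: quotient_cyclic.
have ntGN : G / N i.+1 != 1.
  by apply: contra ncyc => /eqP->; apply: cyclic1.
have notQ : ~ (p = 2 /\ extremal_class (G / N i.+1) = Quaternion).
  case=> p2 clQ; rewrite p2 in pG.
  have [sNG' | ] := orP (cmpN i.+1 lt_i_m); last first.
    move/sub_der1_abelian => abQ.
    by have := quaternion_not_abelian _ _ clQ; rewrite abQ.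
  (* At the trivial term the quotient is [G] itself, which is the only place where the hypothesis on
     quaternion groups enters. *)
  have [N1 | ntN] := eqVneq (N i.+1 : {set gT}) 1.
    apply: nQG; apply: extremal_class_gen_quaternion.
    have /quaternion_classP[n n_gt2 isoQ] := clQ.
    apply/quaternion_classP; exists n => //; apply: isog_trans isoQ.
    by rewrite N1 quotient1_isog.
  exact: (quotient_der1_not_quaternion _ _ _ pG nsNS sNG' ntN).
move/(prime_Ohm1P (quotient_pgroup _ pG) ntGN).
rewrite (negPf ncyc) /= => /andP[/eqP p2 /eqP clQ].
by apply: notQ.
Qed.
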